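(* Let $d\ge 1$ and let $(P_n)_{n\ge 1}$ be a sequence of elements of $\mathscr{P}_d$. Then $$\left(\frac{\nu(P_n)}{P_n}\prod_{1\le j<n}\frac{P_j^*}{P_j}\right)_{n\ge 1}$$ is an orthonormal system in $\mathsf{H}^2_d$.
   Context: $\mathbb{D}=\{z\in\mathbb{C}: |z|<1\}$, and $\partial^*\mathbb{D}^d=\{z\in\mathbb{C}^d: |z_1|=\dots=|z_d|=1\}$ is the distinguished boundary of the polydisk $\mathbb{D}^d$. $\mathsf{H}^2_d=\mathsf{H}^2(\mathbb{D}^d)$ is the Hardy space of the polydisk, with inner product $\langle f,g\rangle=(2\pi)^{-d}\int_{\partial^*\mathbb{D}^d} f(e^{i\theta_1},\dots,e^{i\theta_d})\overline{g(e^{i\theta_1},\dots,e^{i\theta_d})}\,d\theta_1\cdots d\theta_d$ (boundary values) and norm $\|f\|=\sqrt{\langle f,f\rangle}$. For a nonzero polynomial $P\in\mathbb{C}[z_1,\dots,z_d]$, let $\mathrm{d}^\circ P=(m_1,\dots,m_d)$, where $m_i$ is the degree of $P$ with respect to $z_i$; let $\overline{P}$ be the polynomial obtained from $P$ by replacing each coefficient by its complex conjugate; and let $P^*(z)=z_1^{m_1}\cdots z_d^{m_d}\,\overline{P}(z_1^{-1},\dots,z_d^{-1})$. The set $\mathscr{P}_d$ consists of the non-constant polynomials $P\in\mathbb{C}[z_1,\dots,z_d]$ that have no zeros in $\mathbb{D}^d\cup\partial^*\mathbb{D}^d$ and have no (non-constant) common factor with $P^*$. For $P\in\mathscr{P}_d$,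 $\nu(P)=\|P^{-1}\|^{-1}$, where $P^{-1}=1/P$. The empty product equals $1$. *)

(* Defs.v *)
From HB Require Import structures.
From mathcomp Require Import all_boot all_order all_algebra.
From mathcomp Require Import complex.
From mathcomp Require mpoly.
(* The notations of [mpoly] clash with those of the analysis library. *)
Import (canonicals, coercions) mpoly.
From mathcomp Require Import all_classical all_reals all_analysis.

Set Implicit Arguments.
Unset Strict Implicit.
Unset Printing Implicit Defensive.

Import Order.TTheory GRing.Theory Num.Theory.
Import numFieldNormedType.Exports.

Local Open Scope classical_set_scope.
Local Open Scope ring_scope.

Notation "{ 'mpoly' T [ n ] }" := (mpoly.mpoly n T)
  (at level 0, T, n at level 2, format "{ 'mpoly'  T [ n ] }").

Section Reversal.
Variables (d : nat) (C : numClosedFieldType).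
Implicit Types (P Q : {mpoly C[d]}) (z : 'rV[C]_d).

Definition evalp P z : C := mpoly.meval (z ord0) P.

Definition constp P : Prop := exists c : C, P = mpoly.mpolyC d c.

Definition degp P (i : 'I_d) : nat := \max_(m <- mpoly.msupp P) (m i).

Definition conjp P : {mpoly C[d]} := mpoly.map_mpoly Num.conj P.

(* The polynomial z^(degp P) * (conjp P)(1/z), written on coefficients, so that
   divisibility by it makes sense; [starpE] is the defining identity. *)
Definition starp P : {mpoly C[d]} :=
  \sum_(m <- mpoly.msupp (conjp P))
    mpoly.mcoeff m (conjp P) *:
    mpoly.mpolyX C (mpoly.Multinom [tuple (degp P i - m i)%N | i < d]).

Lemma starpE P z : (forall i, z 0 i != 0) ->
  evalp (starp P) z
  = (\prod_(i < d) z 0 i ^+ degp P i) * evalp (conjp P) (\row_i (z 0 i)^-1).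
Proof.
move=> z0; rewrite /evalp /starp raddf_sum/= [in RHS]mpoly.mevalE mulr_sumr.
apply: eq_big_seq => m mP; rewrite mpoly.mevalZ mulrCA; congr (_ * _).
rewrite mpoly.mevalX -big_split/=; apply: eq_bigr => i _.
rewrite mpoly.mnmE mxE.
have h : (m i <= degp P i)%N.
  rewrite /degp.
  apply: (@leq_bigmax_seq _ _ _ (fun m0 : mpoly.multinom d => m0 i)) => //.
  have inj : injective (Num.conj : C -> C) by exact: fmorph_inj.
  by move: mP; rewrite (perm_mem (mpoly.msupp_map_mpoly _ inj)).
by rewrite exprVn expfB_cond// (negPf (z0 i)).
Qed.

End Reversal.

Section LebesgueTuple.
Variable R : realType.
Local Notation rT := (measurableTypeR R).

Definition tuple_cons n (x : rT * n.-tuple rT) : n.+1.-tuple rT :=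
  [tuple of x.1 :: x.2].

Lemma measurable_tuple_cons n : measurable_fun setT (@tuple_cons n).
Proof. exact: measurable_cons. Qed.

Definition lebesgue_cons n
    (mu : {sigma_finite_measure set (n.-tuple rT) -> \bar R}) :
    set (n.+1.-tuple rT) -> \bar R :=
  pushforward (@lebesgue_measure R \x mu)%E (@tuple_cons n).

Section lebesgue_cons_instances.
Variables (n : nat) (mu : {sigma_finite_measure set (n.-tuple rT) -> \bar R}).

Let nu : {measure set (n.+1.-tuple rT) -> \bar R} :=
  measure_function_pushforward__canonical__measure_function_Measure
    (@lebesgue_measure R \x mu)%E (@measurable_tuple_cons n).

HB.instance Definition _ := isMeasure.Build _ _ _ (lebesgue_cons mu)
  (measure0 nu) (measure_ge0 nu) (@measure_semi_sigma_additive _ _ _ nu).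

Let lebesgue_cons_sigma_finite : sigma_finite setT (lebesgue_cons mu).
Proof.
have /sigma_finiteP[F [FT ndF Foo]] := sigma_finiteT (@lebesgue_measure R).
have /sigma_finiteP[G [GT ndG Goo]] := sigma_finiteT mu.
pose g (t : n.+1.-tuple rT) : rT * n.-tuple rT := (thead t, [tuple of behead t]).
have gK : cancel (@tuple_cons n) g.
  by move=> [x t]; congr pair => //; exact: val_inj.
have mg : measurable_fun setT g.
  apply/measurable_fun_pairP; split; first exact: measurable_tnth.
  exact: measurable_behead.
exists (fun k => g @^-1` (F k `*` G k)).
  apply/esym/seteqP; split => // t _.
  have [i _ Fi] : (\bigcup_i F i) (thead t) by rewrite -FT.
  have [j _ Gj] : (\bigcup_i G i) [tuple of behead t] by rewrite -GT.
  exists (maxn i j) => //; split => /=.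
    by move: Fi; exact/subsetPset/ndF/leq_maxl.
  by move: Gj; exact/subsetPset/ndG/leq_maxr.
move=> k; have [mF Fk] := Foo k; have [mG Gk] := Goo k; split.
  by rewrite -[X in measurable X]setTI; apply: mg => //; exact: measurableX.
rewrite /lebesgue_cons /pushforward -comp_preimage.
rewrite (_ : g \o _ = id); last by apply/funext => x; exact: gK.
by rewrite preimage_id product_measure1E// lte_mul_pinfty// ge0_fin_numE.
Qed.

HB.instance Definition _ := Measure_isSigmaFinite.Build _ _ _ (lebesgue_cons mu)
  lebesgue_cons_sigma_finite.

End lebesgue_cons_instances.

(* d-dimensional Lebesgue measure on d-tuples of reals; see
   [lebesgue_tuple_box]. *)
Fixpoint lebesgue_tuple n :
    {sigma_finite_measure set (n.-tuple rT) -> \bar R} :=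
  match n with
  | 0%N => \d_([tuple] : 0.-tuple rT)
  | n'.+1 => lebesgue_cons (lebesgue_tuple n')
  end.

Lemma lebesgue_tuple_box n (A : 'I_n -> set rT) :
  (forall i, measurable (A i)) ->
  lebesgue_tuple n [set t | forall i, A i (tnth t i)]
  = (\prod_(i < n) lebesgue_measure (A i))%E.
Proof.
elim: n A => [|n IH] A mA /=.
  by rewrite big_ord0 diracE mem_set//= => -[].
rewrite big_ord_recl /lebesgue_cons /pushforward.
rewrite (_ : _ @^-1` _ =
  A ord0 `*` [set t | forall i, A (lift ord0 i) (tnth t i)]); last first.
  apply/seteqP; split => -[x t] /=.
    move=> h; split; first by have := h ord0.
    move=> i; have := h (lift ord0 i).
    by rewrite tnthS; congr (A _ (tnth _ _)); exact: val_inj.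
  move=> [h0 h] i; case: (unliftP ord0 i) => [j ->|->//].
  by rewrite tnthS; have := h j; congr (A _ (tnth _ _)); exact: val_inj.
rewrite product_measure1E//; first by congr (_ * _)%E; exact: IH.
rewrite (_ : [set _ | _] = \bigcap_(i in [set: 'I_n])
    ((@tnth n rT ^~ i) @^-1` A (lift ord0 i))); last first.
  by apply/seteqP; split => t /= h i; have := h i => //; apply.
apply: fin_bigcap_measurable => // i _.
by rewrite -[X in measurable X]setTI; exact: measurable_tnth.
Qed.

End LebesgueTuple.

(* [R[i]] packaged as a [numClosedFieldType], so that it receives the topology
   and the normed-module structure that the analysis library attaches to such
   fields; its norm is complex-valued. *)
Definition Cx (R : realType) : numClosedFieldType := R[i].

Section Hardy.
Variables (R : realType) (d : nat).
Local Notation C := (Cx R).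
Implicit Types (f g : 'rV[C]_d -> C) (z : 'rV[C]_d).
Implicit Types (t : d.-tuple (measurableTypeR R)).

Definition polydisk : set 'rV[C]_d := [set z | forall i, `|z 0 i| < 1].

(* The distinguished boundary, parametrized on [angles] by [expi_row]. *)
Definition torus : set 'rV[C]_d := [set z | forall i, `|z 0 i| = 1].

Definition Cof (x : R) : C := (x%:C)%C.

Definition expi_row t : 'rV[C]_d :=
  \row_i ((cos (tnth t i) +i* sin (tnth t i))%C : C).

Definition angles : set (d.-tuple (measurableTypeR R)) :=
  [set t | forall i, 0 <= tnth t i <= 2 * pi].

Definition cintegral (F : d.-tuple (measurableTypeR R) -> C) : C :=
  (\int[lebesgue_tuple R d]_(t in angles) complex.Re (F t)
   +i* \int[lebesgue_tuple R d]_(t in angles) complex.Im (F t))%C.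

(* Radial limit; it exists almost everywhere on the torus when [hardy2 f]. *)
Definition boundary_value f z : C := lim (f (Cof r *: z) @[r --> 1^'-]).

Definition mean_square f (r : R) : \bar R :=
  ((((2 * pi) ^+ d)^-1)%:E * \int[lebesgue_tuple R d]_(t in angles)
    (ComplexField.Normc.normc (f (Cof r *: expi_row t)) ^+ 2)%:E)%E.

(* Holomorphic, i.e. complex (Frechet) differentiable, on the open polydisk with
   bounded quadratic means; the values of [f] off the polydisk are irrelevant. *)
Definition hardy2 f : Prop :=
  (forall z, polydisk z -> differentiable f z) /\
  (ereal_sup [set mean_square f r | r in `]0%R, 1%R[] < +oo)%E.

Definition hinner f g : C :=
  Cof ((2 * pi) ^+ d)^-1 *
  cintegral (fun t => boundary_value f (expi_row t)
                      * (boundary_value g (expi_row t))^*).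

Definition hnorm f : C := sqrtC (hinner f f).

(* For families indexed by the naturals in [D]. *)
Definition orthonormal_system (D : set nat) (f : nat -> 'rV[C]_d -> C) : Prop :=
  (forall n, D n -> hardy2 (f n)) /\
  (forall m n, D m -> D n -> hinner (f m) (f n) = (m == n)%:R).

Definition regular_poly (P : {mpoly C[d]}) : Prop :=
  [/\ ~ constp P,
      forall z, polydisk z \/ torus z -> evalp P z != 0 &
      forall Q A B, P = Q * A -> starp P = Q * B -> constp Q].

Definition pnu (P : {mpoly C[d]}) : C := (hnorm (fun z => (evalp P z)^-1))^-1.

End Hardy.

(* Main.v *)
Require Import Defs.
From HB Require Import structures.
From mathcomp Require Import all_boot all_order all_algebra.
From mathcomp Require Import complex.
From mathcomp Require mpoly.
Import (canonicals, coercions) mpoly.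
From mathcomp Require Import all_classical all_reals all_analysis.
From mathcomp Require Import measurable_realfun.
From mathcomp Require Import ring.

Set Implicit Arguments.
Unset Strict Implicit.
Unset Printing Implicit Defensive.

Import Order.TTheory GRing.Theory Num.Theory.
Import numFieldNormedType.Exports.

Local Open Scope classical_set_scope.
Local Open Scope ring_scope.

(** Everything takes place on the torus, and the only fact about holomorphic
    functions that is needed is the mean value property at the centre, for
    functions whose value there is [0].

    On the torus [conj z_i = 1 / z_i], so
    [P^*(z) = z^(deg P) * conj (P z)] there ([starp_torus]).  Hence [P^* / P] is
    unimodular on the torus, and the integrand of the inner product of the
    [m]-th and the [n]-th function, [m < n], loses its first [m - 1] quotients.
    The [m]-th quotient remains in the second factor; together with [1 / P_m]
    from the first one it yields [conj (z^(deg P_m) / P_m)], so that the whole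
    integrand is a constant times the conjugate of [z^(deg P_m) * h], where [h]
    is a product of polynomials and of inverses of some [P_k].  Since [P_m] is
    not constant, [z^(deg P_m)] vanishes at [0], and the mean value property
    says that the integral is [0] ([system_term_orthogonal]).  For [m = n] all
    the quotients disappear, and [nu(P_n)] is by definition what normalizes
    [1 / P_n] ([system_term_normed]).

    The mean value property is obtained without Cauchy's formula.  It holds for
    polynomials because nontrivial monomials have integral [0] (Fubini and a
    one-dimensional primitive, [cintegral_monomial]), hence for all uniform
    limits of polynomials on the torus ([cintegral_monomial_approx]).  These
    limits form an algebra, and it contains [1 / P] as soon as [P] has no zero
    on the open polydisk and on the torus ([torus_approx_inv]): by compactness
    [|P (r z)|] is bounded below for [0 <= r <= 1] and [z] on the torus, so that
    one can go from the constant [1 / P 0] to [1 / P] along the functions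
    [1 / P (r z)] in finitely many steps, each of them a Neumann series.  The
    same lower bound gives the bounded quadratic means and the radial limits
    that membership in the Hardy space requires. *)

(** * The complex numbers over a real field, and polynomial functions *)
Section ComplexBasics.
Variable R : realType.
Local Notation C := (Cx R).
(* The modulus with real values: the norm of [C] itself is complex-valued. *)
Local Notation nc := (@ComplexField.Normc.normc R).
Implicit Types x y : C.

Lemma conjcE x : Num.conj x = conjc x. Proof. by []. Qed.

Lemma normcE_Cof x : `|x| = Cof (nc x). Proof. by []. Qed.

Lemma nc_ge0 x : 0 <= nc x.
Proof. by case: x => a b; exact: sqrtr_ge0. Qed.

Lemma nc_gt0 x : x != 0 -> 0 < nc x.
Proof.
move=> x0; rewrite lt_def nc_ge0 andbT.
by apply: contra_neq x0; exact: ComplexField.Normc.eq0_normc.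
Qed.

Lemma sqr_nc x : nc x ^+ 2 = complex.Re x ^+ 2 + complex.Im x ^+ 2.
Proof. by case: x => a b /=; rewrite sqr_sqrtr ?addr_ge0 ?sqr_ge0. Qed.

Lemma Re_le_nc x : `|complex.Re x| <= nc x.
Proof.
rewrite -[X in X <= _]sqrtr_sqr -[X in _ <= X](ger0_norm (nc_ge0 x)).
by rewrite -[X in _ <= X]sqrtr_sqr ler_wsqrtr// sqr_nc lerDl sqr_ge0.
Qed.

Lemma Im_le_nc x : `|complex.Im x| <= nc x.
Proof.
rewrite -[X in X <= _]sqrtr_sqr -[X in _ <= X](ger0_norm (nc_ge0 x)).
by rewrite -[X in _ <= X]sqrtr_sqr ler_wsqrtr// sqr_nc lerDr sqr_ge0.
Qed.

Lemma nc_le_ReIm x : nc x <= `|complex.Re x| + `|complex.Im x|.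
Proof.
rewrite -(@ler_pXn2r _ 2)// ?nnegrE ?nc_ge0 ?addr_ge0//.
rewrite sqr_nc sqrrD !real_normK ?num_real// addrAC lerDl mulrn_wge0//.
Qed.

Lemma ncD x y : nc (x + y) <= nc x + nc y.
Proof. exact: le_normcD. Qed.

Lemma ncN x : nc (- x) = nc x.
Proof. exact: normcN. Qed.

Lemma ncM x y : nc (x * y) = nc x * nc y.
Proof. exact: ComplexField.Normc.normcM. Qed.

Lemma ncV x : nc x^-1 = (nc x)^-1.
Proof. exact: ComplexField.Normc.normcV. Qed.

Lemma nc_conj x : nc x^* = nc x.
Proof. by case: x => a b /=; rewrite sqrrN. Qed.

Lemma nc0 : nc 0 = 0. Proof. exact: ComplexField.Normc.normc0. Qed.
Lemma nc1 : nc 1 = 1. Proof. exact: ComplexField.Normc.normc1. Qed.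

Lemma ncX x n : nc (x ^+ n) = nc x ^+ n.
Proof. by elim: n => [|n IH]; rewrite ?expr0 ?nc1// !exprS ncM IH. Qed.

Lemma nc_Cof (r : R) : nc (Cof r) = `|r|.
Proof. by rewrite /= expr0n addr0 sqrtr_sqr. Qed.

Lemma cReD x y : complex.Re (x + y) = complex.Re x + complex.Re y.
Proof. by case: x y => [? ?] []. Qed.

Lemma cImD x y : complex.Im (x + y) = complex.Im x + complex.Im y.
Proof. by case: x y => [? ?] []. Qed.

Lemma cReM x y : complex.Re (x * y) =
  complex.Re x * complex.Re y - complex.Im x * complex.Im y.
Proof. by case: x y => [? ?] []. Qed.

Lemma cImM x y : complex.Im (x * y) =
  complex.Re x * complex.Im y + complex.Im x * complex.Re y.
Proof. by case: x y => [? ?] []. Qed.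

Lemma cRe_conj x : complex.Re x^* = complex.Re x.
Proof. by case: x. Qed.

Lemma cIm_conj x : complex.Im x^* = - complex.Im x.
Proof. by case: x. Qed.

Lemma mulr_conj x : x * x^* = Cof (nc x ^+ 2).
Proof.
have /= -> := esym (sqr_normc x); rewrite normcE_Cof /Cof.
by rewrite (rmorphXn (real_complex R)).
Qed.

Lemma CofB : {morph (@Cof R) : r s / r - s}.
Proof. exact: (raddfB (real_complex R)). Qed.

Lemma CofM : {morph (@Cof R) : r s / r * s}.
Proof. exact: (rmorphM (real_complex R)). Qed.

Lemma conj_Cof (r : R) : (Cof r)^* = Cof r.
Proof. by rewrite conjcE /= oppr0. Qed.

Lemma Cof1 : Cof 1 = 1 :> C. Proof. by []. Qed.
Lemma Cof0 : Cof 0 = 0 :> C. Proof. by []. Qed.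

(** Positive elements of [C] are real, which is what makes the complex-valued
    norm of [C] compatible with real limits. *)
Lemma cvg_Cof (r : R) (F : set_system R) {FF : Filter F} :
  s @[s --> F] --> r -> Cof s @[s --> F] --> (Cof r : C).
Proof.
move=> Fr; apply/cvgrPdist_lt => e e0.
have ee : e = Cof (complex.Re e).
  by case: e e0 => a b; rewrite ltcE /= => /andP[/eqP -> _].
have e'0 : 0 < complex.Re e by move: e0; rewrite ltcE/= => /andP[].
near=> s; rewrite ee -CofB normcE_Cof ltcR nc_Cof.
by near: s; exact: (@cvgr_dist_lt _ _ _ F _ _ _ Fr _ e'0).
Unshelve. all: by end_near. Qed.

End ComplexBasics.

Section PolyClosure.
Variables (R : realType) (d : nat).
Local Notation C := (Cx R).

(** Boundedness, measurability, continuity, differentiability and the like are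
    all obtained for polynomial functions by this one induction; [phi] is the
    way in which the point of evaluation depends on a parameter. *)
Lemma evalp_closed (X : Type) (K : (X -> C) -> Prop) (phi : X -> 'rV[C]_d) :
  (forall c, K (fun=> c)) ->
  (forall f g, K f -> K g -> K (fun x => f x + g x)) ->
  (forall f g, K f -> K g -> K (fun x => f x * g x)) ->
  (forall i, K (fun x => phi x 0 i)) ->
  forall P, K (fun x => evalp P (phi x)).
Proof.
move=> K1 KD KM Kphi P.
have Kprod (I : Type) (s : seq I) (f : I -> X -> C) :
    (forall i, K (f i)) -> K (fun x => \prod_(i <- s) f i x).
  move=> Kf; elim: s => [|i s IH].
    rewrite (_ : (fun _ => _) = fun=> 1)//.
    by apply/funext => x; rewrite big_nil.
  rewrite (_ : (fun _ => _) = fun x => f i x * \prod_(j <- s) f j x); last first.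
    by apply/funext => x; rewrite big_cons.
  exact: KM.
have KX f n : K f -> K (fun x => f x ^+ n).
  move=> Kf; elim: n => [|n IH].
    by rewrite (_ : (fun _ => _) = fun=> 1)//; apply/funext => x; rewrite expr0.
  rewrite (_ : (fun _ => _) = fun x => f x * f x ^+ n); first exact: KM.
  by apply/funext => x; rewrite exprS.
rewrite (_ : (fun _ => _) = fun x => \sum_(m <- mpoly.msupp P)
    mpoly.mcoeff m P * \prod_(i < d) phi x 0 i ^+ m i); last first.
  by apply/funext => x; rewrite /evalp mpoly.mevalE.
elim: (mpoly.msupp P) => [|m s IH].
  by rewrite (_ : (fun _ => _) = fun=> 0)//; apply/funext => x; rewrite big_nil.
rewrite (_ : (fun _ => _) = fun x =>
  mpoly.mcoeff m P * \prod_(i < d) phi x 0 i ^+ m i +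
  \sum_(m <- s) mpoly.mcoeff m P * \prod_(i < d) phi x 0 i ^+ m i); last first.
  by apply/funext => x; rewrite big_cons.
by apply: KD => //; apply: KM => //; apply: Kprod => i; exact: KX.
Qed.

End PolyClosure.

(** * Polynomials on the radii of the closed polydisk that end on the torus *)
Section Torus.
Variables (R : realType) (d : nat).
Local Notation C := (Cx R).
Local Notation nc := (@ComplexField.Normc.normc R).
Local Notation T := (d.-tuple (measurableTypeR R)).
Implicit Types (t : T) (P : {mpoly C[d]}).

Lemma expi_row_coord t i :
  expi_row t 0 i = (cos (tnth t i) +i* sin (tnth t i))%C.
Proof. by rewrite mxE. Qed.

Lemma nc_expi_row t i : nc (expi_row t 0 i) = 1.
Proof. by rewrite expi_row_coord /= cos2Dsin2 sqrtr1. Qed.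

Lemma expi_row_torus t : torus (expi_row t).
Proof. by move=> i; rewrite normcE_Cof nc_expi_row. Qed.

Lemma expi_row_neq0 t i : expi_row t 0 i != 0.
Proof. by rewrite -normr_eq0 expi_row_torus oner_eq0. Qed.

Lemma expi_row_conjV t i : (expi_row t 0 i)^-1 = (expi_row t 0 i)^*.
Proof.
apply: (mulfI (expi_row_neq0 t i)); rewrite mulfV ?expi_row_neq0//.
by rewrite mulr_conj nc_expi_row expr1n.
Qed.

Lemma radial_coord (a : C) t i : (a *: expi_row t) 0 i = a * expi_row t 0 i.
Proof. by rewrite mxE. Qed.

Lemma radial_regular (r : R) t : 0 <= r <= 1 ->
  polydisk (Cof r *: expi_row t) \/ torus (Cof r *: expi_row t).
Proof.
move=> /andP[r0]; rewrite le_eqVlt => /orP[/eqP ->|r1].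
  by right; rewrite Cof1 scale1r; exact: expi_row_torus.
left => i; rewrite mxE normcE_Cof ncM (nc_expi_row t i) mulr1 nc_Cof ger0_norm//.
by rewrite ltcR.
Qed.

(** The radius and the angles range over an honest topological space here, which
    tuples are not, so that compactness becomes available. *)
Lemma evalp_continuous_ReIm P :
  let F (x : R * 'rV[R]_d) :=
    evalp P (Cof x.1 *: expi_row [tuple x.2 0 i | i < d]) in
  continuous (fun x => complex.Re (F x)) /\
  continuous (fun x => complex.Im (F x)).
Proof.
apply: (@evalp_closed R d _
  (fun F : R * 'rV[R]_d -> C => continuous (fun x => complex.Re (F x)) /\
                                continuous (fun x => complex.Im (F x)))).
- by move=> c; split; move=> x; exact: cst_continuous.
- move=> f g [fr fi] [gr gi]; split => x.
    under eq_fun do rewrite cReD.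
    by apply: cvgD; [exact: fr|exact: gr].
  under eq_fun do rewrite cImD.
  by apply: cvgD; [exact: fi|exact: gi].
- move=> f g [fr fi] [gr gi]; split => x.
    under eq_fun do rewrite cReM.
    by apply: cvgB; apply: cvgM; [exact: fr|exact: gr|exact: fi|exact: gi].
  under eq_fun do rewrite cImM.
  by apply: cvgD; apply: cvgM; [exact: fr|exact: gi|exact: fi|exact: gr].
- have c2 i : continuous (fun x : R * 'rV[R]_d => x.2 0 i).
    move=> x; apply: (@continuous_comp _ _ _ snd (fun v : 'rV[R]_d => v 0 i)).
      exact: cvg_snd.
    exact: coord_continuous.
  have c1 : continuous (fun x : R * 'rV[R]_d => x.1) by move=> x; exact: cvg_fst.
  move=> i; split => x.
    rewrite (_ : (fun _ => _) = fun x : R * 'rV[R]_d => x.1 * cos (x.2 0 i)); last first.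
      apply/funext => y; rewrite mxE expi_row_coord tnth_mktuple /=.
      by rewrite mul0r subr0.
    apply: cvgM; first exact: c1.
    by apply: continuous_comp; [exact: c2|exact: continuous_cos].
  rewrite (_ : (fun _ => _) = fun x : R * 'rV[R]_d => x.1 * sin (x.2 0 i)); last first.
    apply/funext => y; rewrite mxE expi_row_coord tnth_mktuple /=.
    by rewrite mul0r addr0.
  apply: cvgM; first exact: c1.
  by apply: continuous_comp; [exact: c2|exact: continuous_sin].
Qed.

(** The parameters form a compact box, and each of its points is sent to the
    open polydisk when [r < 1] and to the torus when [r = 1]. *)
Lemma evalp_radial_lower_bound P :
  (forall z, polydisk z \/ torus z -> evalp P z != 0) ->
  exists2 c : R, 0 < c & forall r t, 0 <= r <= 1 -> angles t ->
    c <= nc (evalp P (Cof r *: expi_row t)).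
Proof.
move=> P0; have [/= cRe cIm] := evalp_continuous_ReIm P.
pose F (x : R * 'rV[R]_d) :=
  evalp P (Cof x.1 *: expi_row [tuple x.2 0 i | i < d]).
pose A : set (R * 'rV[R]_d) :=
  `[0, 1]%classic `*` [set v : 'rV[R]_d | forall i, `[0, 2 * pi]%classic (v ord0 i)].
have cA : compact A.
  apply: compact_setX; first exact: segment_compact.
  apply: (@rV_compact R d (fun=> `[0, 2 * pi]%classic)) => i.
  exact: segment_compact.
have A0 : A !=set0.
  exists (0, 0); split => /=; first by rewrite in_itv/= lexx ler01.
  by move=> i; rewrite mxE in_itv/= lexx mulr_ge0// pi_ge0.
have [|x xA xmin] := @compact_EVT_min _ R (fun x => nc (F x) ^+ 2) A A0 cA.
  apply: continuous_subspaceT => x.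
  rewrite (_ : (fun _ => _) = fun x =>
    complex.Re (F x) * complex.Re (F x) + complex.Im (F x) * complex.Im (F x)).
    by apply: cvgD; apply: cvgM;
      [exact: cRe|exact: cRe|exact: cIm|exact: cIm].
  by apply/funext => y; rewrite sqr_nc !expr2.
have [x01 _] := set_mem xA.
exists (nc (F x)).
  apply/nc_gt0/P0/radial_regular.
  by move: x01; rewrite /= in_itv.
move=> r t r01 ta.
have Art : A (r, \row_i tnth t i).
  by split => [|i]; rewrite /= ?mxE in_itv/=.
have tE : [tuple (\row_j tnth t j : 'rV[R]_d) 0 i | i < d] = t.
  by apply: eq_from_tnth => i; rewrite tnth_mktuple mxE.
have := xmin _ (mem_set Art); rewrite /F/= tE.
by rewrite ler_pXn2r// nnegrE nc_ge0.
Qed.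

(** The two properties are proved together because the Lipschitz constant of a
    product involves the bounds of its factors. *)
Lemma evalp_radial_bounded_lipschitz P :
  let F r t := evalp P (Cof r *: expi_row t) in
  (exists2 M : R, 0 <= M & forall r t, 0 <= r <= 1 -> nc (F r t) <= M) /\
  (exists2 L : R, 0 <= L & forall r s t, 0 <= r <= 1 -> 0 <= s <= 1 ->
    nc (F r t - F s t) <= L * `|r - s|).
Proof.
pose K (F : R * T -> C) :=
  (exists2 M : R, 0 <= M & forall r t, 0 <= r <= 1 -> nc (F (r, t)) <= M) /\
  (exists2 L : R, 0 <= L & forall r s t, 0 <= r <= 1 -> 0 <= s <= 1 ->
    nc (F (r, t) - F (s, t)) <= L * `|r - s|).
apply: (@evalp_closed R d _ K (fun x => Cof x.1 *: expi_row x.2)).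
- move=> c; split; first by exists (nc c); rewrite ?nc_ge0.
  by exists 0 => // r s t _ _; rewrite subrr nc0 mul0r.
- move=> f g [[M M0 fM] [L L0 fL]] [[N N0 gN] [L' L'0 gL]]; split.
    exists (M + N) => [|r t r01]; first exact: addr_ge0.
    by apply: le_trans (ncD _ _) _; rewrite lerD ?fM ?gN.
  exists (L + L') => [|r s t r01 s01]; first exact: addr_ge0.
  rewrite opprD addrACA; apply: le_trans (ncD _ _) _.
  by rewrite mulrDl lerD ?fL ?gL.
- move=> f g [[M M0 fM] [L L0 fL]] [[N N0 gN] [L' L'0 gL]]; split.
    exists (M * N) => [|r t r01]; first exact: mulr_ge0.
    by rewrite ncM ler_pM ?nc_ge0 ?fM ?gN.
  exists (M * L' + L * N) => [|r s t r01 s01]; first by rewrite addr_ge0 ?mulr_ge0.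
  rewrite (_ : _ - _ = f (r, t) * (g (r, t) - g (s, t)) +
      (f (r, t) - f (s, t)) * g (s, t)); last first.
    by rewrite mulrBr mulrBl addrA subrK.
  apply: le_trans (ncD _ _) _; rewrite !ncM mulrDl -!mulrA.
  apply: lerD; first by rewrite ler_pM ?nc_ge0 ?fM ?gL.
  by rewrite (mulrC N) mulrA ler_pM ?nc_ge0 ?fL ?gN.
- move=> i; split.
    exists 1 => // r t /andP[r0 r1].
    by rewrite radial_coord ncM nc_expi_row mulr1 nc_Cof ger0_norm.
  exists 1 => // r s t _ _.
  by rewrite !radial_coord -mulrBl ncM nc_expi_row mulr1 mul1r -CofB nc_Cof.
Qed.

End Torus.

(** * Uniform limits of polynomials on the torus *)
Section Approximation.
Variables (R : realType) (d : nat).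
Local Notation C := (Cx R).
Local Notation nc := (@ComplexField.Normc.normc R).
Local Notation T := (d.-tuple (measurableTypeR R)).
Implicit Types (t : T) (P : {mpoly C[d]}) (F G : T -> C).

Definition torus_approx F := forall e : R, 0 < e -> exists p : {mpoly C[d]},
  forall t, angles t -> nc (F t - evalp p (expi_row t)) <= e.

Lemma evalp_torus_bounded P :
  exists2 M : R, 0 <= M & forall t, nc (evalp P (expi_row t)) <= M.
Proof.
have [[M M0 PM] _] := evalp_radial_bounded_lipschitz P.
exists M => // t; have := PM 1 t; rewrite Cof1 scale1r; apply.
by rewrite ler01 lexx.
Qed.

Lemma torus_approx_bounded F : torus_approx F ->
  exists2 M : R, 0 <= M & forall t, angles t -> nc (F t) <= M.
Proof.
move=> /(_ 1 ltr01)[p Fp]; have [M M0 pM] := evalp_torus_bounded p.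
exists (1 + M) => [|t ta]; first by rewrite addr_ge0.
rewrite -[F t](subrK (evalp p (expi_row t))).
by apply: le_trans (ncD _ _) _; rewrite lerD ?Fp.
Qed.

Lemma torus_approx_evalp P : torus_approx (fun t => evalp P (expi_row t)).
Proof. by move=> e e0; exists P => t _; rewrite subrr nc0 ltW. Qed.

Lemma torus_approx_cst (c : C) : torus_approx (fun=> c).
Proof.
move=> e e0; exists (mpoly.mpolyC d c) => t _.
by rewrite /evalp mpoly.mevalC subrr nc0 ltW.
Qed.

Lemma torus_approxD F G : torus_approx F -> torus_approx G ->
  torus_approx (fun t => F t + G t).
Proof.
move=> aF aG e e0; have e2 : 0 < e / 2 by rewrite divr_gt0.
have [p Fp] := aF _ e2; have [q Gq] := aG _ e2.
exists (p + q) => t ta; rewrite /evalp mpoly.mevalD opprD addrACA.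
by apply: le_trans (ncD _ _) _; rewrite [leRHS]splitr lerD ?Fp ?Gq.
Qed.

Lemma torus_approx_lim F :
  (forall e : R, 0 < e -> exists2 G, torus_approx G &
    forall t, angles t -> nc (F t - G t) <= e) -> torus_approx F.
Proof.
move=> FG e e0; have e2 : 0 < e / 2 by rewrite divr_gt0.
have [G aG Ge] := FG _ e2; have [p Gp] := aG _ e2.
exists p => t ta; rewrite -[F t](subrK (G t)) -addrA.
by apply: le_trans (ncD _ _) _; rewrite [leRHS]splitr lerD ?Ge ?Gp.
Qed.

Lemma torus_approxM F G : torus_approx F -> torus_approx G ->
  torus_approx (fun t => F t * G t).
Proof.
move=> aF aG e e0; have [M M0 FM] := torus_approx_bounded aF.
have M1 : 0 < M + 1 by rewrite ltr_wpDl.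
have e2 : 0 < e / 2 by rewrite divr_gt0.
have [q Gq] := aG _ (divr_gt0 e2 M1).
have [N N0 qN] := evalp_torus_bounded q.
have N1 : 0 < N + 1 by rewrite ltr_wpDl.
have [p Fp] := aF _ (divr_gt0 e2 N1).
exists (p * q) => t ta; rewrite /evalp mpoly.mevalM -!/(evalp _ _).
set p' := evalp p _; set q' := evalp q _.
rewrite (_ : _ - _ = F t * (G t - q') + (F t - p') * q'); last first.
  by rewrite mulrBr mulrBl addrA subrK.
apply: le_trans (ncD _ _) _; rewrite !ncM [leRHS]splitr lerD//.
  rewrite -[leRHS](divfK (lt0r_neq0 M1)) [leRHS]mulrC.
  by rewrite ler_pM ?nc_ge0 ?Gq// (le_trans (FM _ ta))// lerDl.
rewrite -[leRHS](divfK (lt0r_neq0 N1)).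
by rewrite ler_pM ?nc_ge0 ?Fp// (le_trans (qN _))// lerDl.
Qed.

Lemma torus_approxX F n : torus_approx F -> torus_approx (fun t => F t ^+ n).
Proof.
move=> aF; elim: n => [|n IH].
  by under eq_fun do rewrite expr0; exact: torus_approx_cst.
by under eq_fun do rewrite exprS; exact: torus_approxM.
Qed.

Lemma torus_approx_sum n (F : nat -> T -> C) :
  (forall k, torus_approx (F k)) ->
  torus_approx (fun t => \sum_(k < n) F k t).
Proof.
move=> aF; elim: n => [|n IH].
  by under eq_fun do rewrite big_ord0; exact: torus_approx_cst.
by under eq_fun do rewrite big_ord_recr; exact: torus_approxD.
Qed.

Lemma torus_approx_radial P (r : R) :
  torus_approx (fun t => evalp P (Cof r *: expi_row t)).
Proof.
apply: (@evalp_closed R d _ torus_approx (fun t => Cof r *: expi_row t)).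
- exact: torus_approx_cst.
- exact: torus_approxD.
- exact: torus_approxM.
- move=> i; under eq_fun do rewrite radial_coord.
  apply: torus_approxM; first exact: torus_approx_cst.
  under eq_fun => t do rewrite -(@mpoly.mevalXU _ _ (expi_row t ord0)).
  exact: torus_approx_evalp.
Qed.

(** Neumann series: with [u = (F - G) / F] one has [1 / G = 1 / F * 1 / (1 - u)]
    and [|u| <= 1 / 2], so that the partial sums of [1 / F * sum u ^ k] converge
    uniformly to [1 / G]. *)
Lemma torus_approx_inv_near F G (c : R) : 0 < c ->
  torus_approx F -> torus_approx G -> torus_approx (fun t => (F t)^-1) ->
  (forall t, angles t -> c <= nc (F t)) ->
  (forall t, angles t -> nc (F t - G t) <= c / 2) ->
  torus_approx (fun t => (G t)^-1).
Proof.
move=> c0 aF aG aFV cF FG; pose u t := (F t - G t) * (F t)^-1.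
have au : torus_approx u.
  apply: torus_approxM => //; apply: torus_approxD => //.
  under eq_fun do rewrite -mulN1r.
  by apply: torus_approxM => //; exact: torus_approx_cst.
apply: torus_approx_lim => e e0.
have c2 : 0 < c / 2 by rewrite divr_gt0.
(* The remainder [u ^ n / G] of the series is at most [(1 / 2) ^ n] times
   [2 / c], because [|G| >= c / 2]. *)
have [n ne] : exists n, (1 / 2) ^+ n * (c / 2)^-1 <= e.
  have [n nP] : exists n, (c / 2)^-1 / e < n%:R.
    exists (Num.bound ((c / 2)^-1 / e)); apply: archi_boundP.
    by rewrite divr_ge0 ?invr_ge0 ?(ltW c2) ?(ltW e0).

  exists n; rewrite div1r exprVn mulrC ler_pdivrMr ?exprn_gt0//.
  rewrite [e * _]mulrC -ler_pdivrMr//; apply: ltW; apply: lt_trans nP _.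
  by rewrite -natrX ltr_nat ltn_expl.
exists (fun t => (F t)^-1 * \sum_(k < n) u t ^+ k).
  apply: torus_approxM => //.
  by apply: (@torus_approx_sum n (fun k t => u t ^+ k)) => k; exact: torus_approxX.
move=> t ta.
have F0 : F t != 0.
  apply/eqP => F0; have := cF _ ta.
  by rewrite F0 nc0 leNgt c0.
have Gc : c / 2 <= nc (G t).
  rewrite -(lerD2l (c / 2)) -splitr; apply: le_trans (cF _ ta) _.
  by rewrite -[X in nc X](subrK (G t)); apply: le_trans (ncD _ _) _; rewrite lerD2r FG.
have G0 : G t != 0.
  by apply/eqP => G0; move: Gc; rewrite G0 nc0 leNgt c2.
have GE : G t = F t * (1 - u t).
  by rewrite /u mulrBr mulr1 mulrCA mulfV// mulr1 subKr.
have -> : (G t)^-1 - (F t)^-1 * (\sum_(k < n) u t ^+ k) = u t ^+ n * (G t)^-1.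
  apply: (mulfI G0); rewrite mulrBr mulfV// [RHS]mulrCA mulfV// mulr1.
  rewrite [X in X * (_ * _)]GE mulrACA mulfV// mul1r.
  by rewrite -[1 - u t]opprB mulNr -subrX1 opprK addrC subrK.
rewrite ncM ncX ncV; apply: le_trans _ ne.
rewrite ler_pM ?exprn_ge0 ?invr_ge0 ?nc_ge0//; last first.
  by rewrite lef_pV2 ?posrE// (lt_le_trans c2).
rewrite lerXn2r ?nnegrE ?nc_ge0 ?divr_ge0//.
rewrite /u ncM ncV ler_pdivrMr ?(lt_le_trans c0) ?cF//.
apply: le_trans (FG _ ta) _; rewrite div1r mulrC.
by rewrite ler_pM2l ?invr_gt0// cF.
Qed.

(** The polynomials [P (k / N * z)], [k = 0, ..., N], start with a constant and
    end with [P]; they are all bounded below by the same [c] on the torus, and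
    for large [N] consecutive ones differ by at most [c / 2]. *)
Lemma torus_approx_inv P :
  (forall z, polydisk z \/ torus z -> evalp P z != 0) ->
  torus_approx (fun t => (evalp P (expi_row t))^-1).
Proof.
move=> P0; have [c c0 Pc] := evalp_radial_lower_bound P0.
have [_ [L L0 PL]] := evalp_radial_bounded_lipschitz P.
have [N NP] : exists N, L / (c / 2) < N%:R.
  by exists (Num.bound (L / (c / 2))); apply: archi_boundP; rewrite !divr_ge0 ?(ltW c0).
have c2 : 0 < c / 2 by rewrite divr_gt0.
have N0 : 0 < N%:R :> R by apply: le_lt_trans NP; rewrite divr_ge0// ltW.
have step k : (k <= N)%N ->
    torus_approx (fun t => (evalp P (Cof (k%:R / N%:R) *: expi_row t))^-1).
  elim: k => [_|k IH kN].
    under eq_fun do rewrite mul0r Cof0 scale0r.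
    exact: torus_approx_cst.
  have k01 j : (j <= N)%N -> 0 <= (j%:R / N%:R : R) <= 1.
    by move=> jN; rewrite divr_ge0//= ler_pdivrMr// mul1r ler_nat.
  apply: (torus_approx_inv_near c0 _ _ (IH (ltnW kN))) => //.
  - exact: torus_approx_radial.
  - exact: torus_approx_radial.
  - by move=> t ta; rewrite Pc// k01// ltnW.
  - move=> t ta; apply: le_trans (PL _ _ _ (k01 _ (ltnW kN)) (k01 _ kN)) _.
    rewrite distrC -mulrBl -natrB// subSnn div1r ger0_norm ?invr_ge0 ?(ltW N0)//.
    by rewrite ler_pdivrMr// [leRHS]mulrC -ler_pdivrMr// ltW.
have N1 : Cof (N%:R / N%:R) = 1 :> C by rewrite divff ?lt0r_neq0.
rewrite (_ : (fun _ => _) =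
  fun t => (evalp P (Cof (N%:R / N%:R) *: expi_row t))^-1); first exact: step.
by apply/funext => t; rewrite N1 scale1r.
Qed.

End Approximation.

(** * Integration of bounded complex functions on the torus *)
Section ComplexIntegral.
Variables (R : realType) (d : nat).
Local Notation C := (Cx R).
Local Notation nc := (@ComplexField.Normc.normc R).
Local Notation T := (d.-tuple (measurableTypeR R)).
Local Notation mu := (lebesgue_tuple R d).
Local Notation cintegral := (@cintegral R d).
Implicit Types (t : T) (P : {mpoly C[d]}) (F G : T -> C).

Definition cmeasurable F :=
  measurable_fun setT (fun t => complex.Re (F t)) /\
  measurable_fun setT (fun t => complex.Im (F t)).

Definition tame F := cmeasurable F /\
  exists2 M : R, 0 <= M & forall t, angles t -> nc (F t) <= M.

Lemma cmeasurable_cst (c : C) : cmeasurable (fun=> c).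
Proof. by split; exact: measurable_cst. Qed.

Lemma cmeasurableD F G : cmeasurable F -> cmeasurable G ->
  cmeasurable (fun t => F t + G t).
Proof.
move=> [Fr Fi] [Gr Gi]; split.
  by under eq_fun do rewrite cReD; exact: measurable_funD.
by under eq_fun do rewrite cImD; exact: measurable_funD.
Qed.

Lemma cmeasurableM F G : cmeasurable F -> cmeasurable G ->
  cmeasurable (fun t => F t * G t).
Proof.
move=> [Fr Fi] [Gr Gi]; split.
  under eq_fun do rewrite cReM.
  by apply: measurable_funB; exact: measurable_funM.
under eq_fun do rewrite cImM.
by apply: measurable_funD; exact: measurable_funM.
Qed.

Lemma cmeasurable_conj F : cmeasurable F -> cmeasurable (fun t => (F t)^*).
Proof.
move=> [Fr Fi]; split.
  by under eq_fun do rewrite cRe_conj.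
under eq_fun do rewrite cIm_conj.
exact: measurable_funN.
Qed.

Lemma measurable_inv_real : measurable_fun setT (GRing.inv : R -> R).
Proof.
rewrite -(setUv [set 0 : R]); apply/measurable_funU => //.
  exact: measurableC.
split; first exact: measurable_fun_set1.
apply: open_continuous_measurable_fun.
  by rewrite openC; exact: closed_eq.
by move=> x; rewrite inE /= => /eqP x0; exact: inv_continuous.
Qed.

Lemma cmeasurable_nc2 F : cmeasurable F ->
  measurable_fun setT (fun t => nc (F t) ^+ 2).
Proof.
move=> [Fr Fi]; under eq_fun do rewrite sqr_nc.
by apply: measurable_funD; exact: measurable_funX.
Qed.

Lemma cmeasurableV F : cmeasurable F -> cmeasurable (fun t => (F t)^-1).
Proof.
move=> mF; have [Fr Fi] := mF.
have mV : measurable_fun setT (fun t => (nc (F t) ^+ 2)^-1).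
  by apply: measurableT_comp; [exact: measurable_inv_real|exact: cmeasurable_nc2].
split.
  rewrite (_ : (fun _ => _) =
    fun t => complex.Re (F t) * (nc (F t) ^+ 2)^-1); first exact: measurable_funM.
  by apply/funext => t; rewrite sqr_nc; case: (F t).
rewrite (_ : (fun _ => _) =
  fun t => - (complex.Im (F t)) * (nc (F t) ^+ 2)^-1).
  by apply: measurable_funM => //; exact: measurable_funN.
by apply/funext => t; rewrite sqr_nc mulNr; case: (F t).
Qed.

Lemma cmeasurable_radial P (r : R) :
  cmeasurable (fun t => evalp P (Cof r *: expi_row t)).
Proof.
apply: (@evalp_closed R d _ cmeasurable (fun t => Cof r *: expi_row t)).
- exact: cmeasurable_cst.
- exact: cmeasurableD.
- exact: cmeasurableM.
- move=> i; under eq_fun do rewrite radial_coord expi_row_coord.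
  apply: cmeasurableM; first exact: cmeasurable_cst.
  by split => /=; apply: measurableT_comp;
    do ?exact: measurable_tnth; apply: continuous_measurable_fun;
    [exact: continuous_cos|exact: continuous_sin].
Qed.

Lemma tame_cst (c : C) : tame (fun=> c).
Proof. by split; [exact: cmeasurable_cst|exists (nc c); rewrite ?nc_ge0]. Qed.

Lemma tameD F G : tame F -> tame G -> tame (fun t => F t + G t).
Proof.
move=> [mF [M M0 FM]] [mG [N N0 GN]]; split; first exact: cmeasurableD.
exists (M + N) => [|t ta]; first exact: addr_ge0.
by apply: le_trans (ncD _ _) _; rewrite lerD ?FM ?GN.
Qed.

Lemma tameM F G : tame F -> tame G -> tame (fun t => F t * G t).
Proof.
move=> [mF [M M0 FM]] [mG [N N0 GN]]; split; first exact: cmeasurableM.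
exists (M * N) => [|t ta]; first exact: mulr_ge0.
by rewrite ncM ler_pM ?nc_ge0 ?FM ?GN.
Qed.

Lemma tame_conj F : tame F -> tame (fun t => (F t)^*).
Proof.
move=> [mF [M M0 FM]]; split; first exact: cmeasurable_conj.
by exists M => // t ta; rewrite nc_conj FM.
Qed.

Lemma tame_evalp P : tame (fun t => evalp P (expi_row t)).
Proof.
split; last by have [M M0 PM] := evalp_torus_bounded P; exists M.
under eq_fun => t do rewrite -[expi_row t]scale1r -Cof1.
exact: cmeasurable_radial.
Qed.

Lemma measurable_angles : measurable (@angles R d).
Proof.
rewrite (_ : @angles R d = \bigcap_(i in [set: 'I_d])
    ((@tnth d (measurableTypeR R) ^~ i) @^-1` `[0, 2 * pi]%classic)).
  apply: fin_bigcap_measurable => // i _.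
  by rewrite -[X in measurable X]setTI; exact: measurable_tnth.
apply/seteqP; split => t h i => [_ /=|]; first by rewrite in_itv/=; exact: h.
by have := h i I; rewrite /= in_itv.
Qed.

Lemma lebesgue_tuple_angles : mu (@angles R d) = ((2 * pi) ^+ d)%:E.
Proof.
have := @lebesgue_tuple_box R d (fun=> `[0, 2 * pi]%classic) (fun=> measurable_itv _).
rewrite (_ : [set _ | _] = @angles R d); last first.
  by apply/seteqP; split => t h i; have := h i; rewrite /= in_itv.
move=> ->; rewrite (eq_bigr (fun=> (2 * pi)%:E)).
  by rewrite prodEFin prodr_const card_ord.
move=> i _; rewrite lebesgue_measure_itv/= lte_fin.
by rewrite mulr_gt0 ?pi_gt0// sube0.
Qed.

Lemma finite_angles : (mu (@angles R d) < +oo)%E.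
Proof. by rewrite lebesgue_tuple_angles ltry. Qed.

Lemma integrable_bounded (f : T -> R) (M : R) : measurable_fun setT f ->
  (forall t, angles t -> `|f t| <= M) -> mu.-integrable (@angles R d) (EFin \o f).
Proof.
move=> mf fM; apply: measurable_bounded_integrable.
- exact: measurable_angles.
- exact: finite_angles.
- exact: measurable_funTS.
- by exists M; split; [exact: num_real|move=> x /ltW Mx t ta; exact: le_trans (fM _ ta) Mx].
Qed.

Lemma tame_integrable F : tame F ->
  mu.-integrable (@angles R d) (EFin \o (fun t => complex.Re (F t))) /\
  mu.-integrable (@angles R d) (EFin \o (fun t => complex.Im (F t))).
Proof.
move=> [[Fr Fi] [M M0 FM]]; split; apply: (@integrable_bounded _ M) => // t ta.
  by apply: le_trans (Re_le_nc _) _; exact: FM.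
by apply: le_trans (Im_le_nc _) _; exact: FM.
Qed.

Lemma eq_cintegral F G : (forall t, angles t -> F t = G t) ->
  cintegral F = cintegral G.
Proof.
move=> FG; rewrite /Defs.cintegral; congr (_ +i* _)%C;
  by apply: eq_Rintegral => t; rewrite inE => ta; rewrite FG.
Qed.

Lemma cintegralD F G : tame F -> tame G ->
  cintegral (fun t => F t + G t) = cintegral F + cintegral G.
Proof.
move=> /tame_integrable[Fr Fi] /tame_integrable[Gr Gi].
rewrite /Defs.cintegral; under eq_Rintegral do rewrite cReD.
under [X in (_ +i* X)%C]eq_Rintegral do rewrite cImD.
by rewrite !RintegralD//; exact: measurable_angles.
Qed.

Lemma cintegralZl (c : C) F : tame F ->
  cintegral (fun t => c * F t) = c * cintegral F.
Proof.
case: c => a b /tame_integrable[Fr Fi].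
have mA := measurable_angles.
have iZ (k : R) f : mu.-integrable (@angles R d) (EFin \o f) ->
    mu.-integrable (@angles R d) (EFin \o (fun t => k * f t)).
  by move=> /(integrableZl mA k).
rewrite /Defs.cintegral; under eq_Rintegral do rewrite cReM /=.
under [X in (_ +i* X)%C]eq_Rintegral do rewrite cImM /=.
rewrite RintegralB//; [|exact: iZ|exact: iZ].
rewrite RintegralD//; [|exact: iZ|exact: iZ].
by rewrite !RintegralZl.
Qed.

Lemma cintegral_conj F : tame F ->
  cintegral (fun t => (F t)^*) = (cintegral F)^*.
Proof.
move=> /tame_integrable[Fr Fi]; rewrite /Defs.cintegral conjcE /=; congr (_ +i* _)%C.
  by apply: eq_Rintegral => t _; rewrite cRe_conj.
rewrite -mulN1r -RintegralZl//; last exact: measurable_angles.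
by apply: eq_Rintegral => t _; rewrite mulN1r cIm_conj.
Qed.

(** The factor [2] comes from bounding the real and the imaginary part
    separately. *)
Lemma cintegral_bound F (M : R) : tame F ->
  (forall t, angles t -> nc (F t) <= M) ->
  nc (cintegral F) <= 2 * M * (2 * pi) ^+ d.
Proof.
move=> tF FM; have [Fr Fi] := tame_integrable tF.
have mA := measurable_angles.
have bound f : mu.-integrable (@angles R d) (EFin \o f) ->
    (forall t, angles t -> `|f t| <= M) ->
    `|\int[mu]_(t in @angles R d) f t| <= M * (2 * pi) ^+ d.
  move=> fi fM; apply: le_trans (le_normr_Rintegral mA fi) _.
  have -> : M * (2 * pi) ^+ d = \int[mu]_(t in @angles R d) M.
    rewrite Rintegral_cst//; congr (_ * _).
    exact: (esym (congr1 fine lebesgue_tuple_angles)).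
  apply: le_Rintegral => //; first exact: integrable_norm.
  by apply: (@integrable_bounded _ `|M|) => //; exact: measurable_cst.
apply: le_trans (nc_le_ReIm _) _; rewrite -mulrA mulr_natl mulr2n lerD//=.
  by apply: bound => // t ta; apply: le_trans (Re_le_nc _) (FM _ ta).
by apply: bound => // t ta; apply: le_trans (Im_le_nc _) (FM _ ta).
Qed.

End ComplexIntegral.

(** * Powers of the exponential over one period *)
Section MonomialIntegral.
Variable R : realType.
Local Notation C := (Cx R).
Local Notation leb := (@lebesgue_measure R).
Local Notation period := (`[0, 2 * pi]%classic : set R).

Lemma Rintegral_derive_periodic (f F : R -> R) :
  (forall x : R, is_derive x (1 : R) F (f x)) -> continuous f -> F (2 * pi) = F 0 ->
  \int[leb]_(x in period) f x = 0.
Proof.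
move=> dF cf F2; rewrite /Rintegral.
have cF : continuous F.
  move=> x; apply: differentiable_continuous; apply/derivable1_diffP.
  by have [] := dF x.
rewrite (@continuous_FTC2 _ f F) ?F2 ?subee//.
- by rewrite mulr_gt0 ?pi_gt0.
- exact: continuous_subspaceT.
- split; first by move=> x _; have [] := dF x.
    by apply: cvg_at_right_filter; exact: cF.
  by apply: cvg_at_left_filter; exact: cF.
- by move=> x _; rewrite derive1E; exact: derive_val.
Qed.

Lemma cos_sin_exp (x : R) k :
  ((cos x +i* sin x)%C : C) ^+ k = (cos (k%:R * x) +i* sin (k%:R * x))%C.
Proof.
elim: k => [|k IH]; first by rewrite expr0 mul0r cos0 sin0.
rewrite exprS IH -natr1 mulrDl mul1r [k%:R * x + x]addrC cosD sinD.
by congr (_ +i* _)%C; rewrite /= [RHS]addrC.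
Qed.

Definition cintegral1 (a : R -> C) : C :=
  (\int[leb]_(x in period) complex.Re (a x)
   +i* \int[leb]_(x in period) complex.Im (a x))%C.

Lemma cintegral1_exp k : (0 < k)%N ->
  cintegral1 (fun x => ((cos x +i* sin x)%C : C) ^+ k) = 0.
Proof.
move=> k0; have k1 : k%:R != 0 :> R by rewrite pnatr_eq0 -lt0n.
have cM : continuous (fun x : R => k%:R * x) by exact: mulrl_continuous.
have twopi : k%:R * (2 * pi) = 0 + pi *+ 2 *+ k :> R.
  by rewrite add0r !mulr_natl.
rewrite /cintegral1 (_ : 0 = 0 +i* 0)%C//.
congr (_ +i* _)%C; under eq_Rintegral do rewrite cos_sin_exp /=.
  apply: (@Rintegral_derive_periodic _ (fun x => k%:R^-1 * sin (k%:R * x))).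
  - move=> x; apply: is_derive_eq.
    by rewrite /GRing.scale /= mulr1 mulrCA mulVf// mulr1.
  - by move=> x; apply: continuous_comp; [exact: cM|exact: continuous_cos].
  - by rewrite twopi mulr0 (periodicn (@sinD2pi R)).
apply: (@Rintegral_derive_periodic _ (fun x => - (k%:R^-1 * cos (k%:R * x)))).
- move=> x; apply: is_derive_eq.
  by rewrite /GRing.scale /= mulr1 mulNr mulrN opprK mulrCA mulVf// mulr1.
- by move=> x; apply: continuous_comp; [exact: cM|exact: continuous_sin].
- by rewrite twopi mulr0 (periodicn (@cosD2pi R)).
Qed.

End MonomialIntegral.

(** * Integrals of tensor products *)
Section TensorIntegral.
Variables (R : realType) (n : nat).
Local Notation rT := (measurableTypeR R).
Local Notation leb := (@lebesgue_measure R).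
Local Notation mu := (lebesgue_tuple R n).
Local Notation period := (`[0, 2 * pi]%classic : set rT).

(** Fubini for the recursive definition of the measure on tuples; the bounds
    are only there to ensure integrability. *)
Lemma Rintegral_tensor (f : rT -> R) (g : n.-tuple rT -> R) (M N : R) :
  measurable_fun setT f -> measurable_fun setT g ->
  (forall x, `|f x| <= M) -> (forall t, angles t -> `|g t| <= N) ->
  \int[lebesgue_tuple R n.+1]_(t in @angles R n.+1)
      (f (thead t) * g [tuple of behead t])
  = (\int[leb]_(x in period) f x) * \int[mu]_(t in @angles R n) g t.
Proof.
move=> mf mg fM gN.
pose A := period `*` @angles R n.
have mP : measurable period by exact: measurable_itv.
have mAn := @measurable_angles R n.
have mA : measurable A by exact: measurableX.
have Pfin : (leb period < +oo)%E.
  by rewrite /= lebesgue_measure_itv/=; case: ifP => _; rewrite -?EFinB ltry.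
have Afin : ((leb \x mu)%E A < +oo)%E.
  rewrite /A product_measure1E//; apply: lte_mul_pinfty => //.
  - by rewrite ge0_fin_numE.
  - exact: finite_angles.
have preA : @tuple_cons R n @^-1` @angles R n.+1 = A.
  apply/seteqP; split => -[x t] /=.
    move=> h; split; first by have := h ord0; rewrite /= in_itv.
    move=> i; have := h (lift ord0 i).
    by rewrite tnthS; congr (0 <= tnth _ _ <= _); exact: val_inj.
  move=> [h0 h] i; case: (unliftP ord0 i) => [j ->|->].
    by rewrite tnthS; have := h j; congr (0 <= tnth _ _ <= _); exact: val_inj.
  by move: h0; rewrite /= in_itv.
have consK (x : rT * n.-tuple rT) : f (thead (tuple_cons x)) *
    g [tuple of behead (tuple_cons x)] = f x.1 * g x.2.
  by case: x => x t; congr (_ * g _); exact: val_inj.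
have mH : measurable_fun setT (fun t : n.+1.-tuple rT =>
    f (thead t) * g [tuple of behead t]).
  apply: measurable_funM; apply: measurableT_comp => //.
    exact: measurable_tnth.
  exact: measurable_behead.
have iH : (leb \x mu)%E.-integrable A (EFin \o (fun x => f x.1 * g x.2)).
  apply: measurable_bounded_integrable => //.
    apply: measurable_funTS; apply: measurable_funM; apply: measurableT_comp => //.
  exists (`|M| * `|N|); split; first exact: num_real.
  move=> K MK x [_ xA]; apply: le_trans _ (ltW MK).
  rewrite normrM ler_pM//; first exact: le_trans (fM _) (ler_norm _).
  exact: le_trans (gN _ xA) (ler_norm _).
have intf : leb.-integrable period (EFin \o f).
  apply: measurable_bounded_integrable => //; first exact: measurable_funTS.
  exists M; split; first exact: num_real.
  by move=> K MK x _; exact: le_trans (fM x) (ltW MK).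
have intg : mu.-integrable (@angles R n) (EFin \o g) by exact: integrable_bounded gN.
rewrite /Rintegral -fineM; [|exact: integrable_fin_num|exact: integrable_fin_num].
congr fine.
transitivity (\int[(leb \x mu)%E]_(x in A) (f x.1 * g x.2)%:E)%E.
  rewrite -preA /=.
  rewrite (@integral_pushforward _ _ _ _ R _ (@measurable_tuple_cons R n)
    (leb \x mu)%E (@angles R n.+1)
    (fun t => (f (thead t) * g [tuple of behead t])%:E)).
  - by apply: eq_integral => x _; rewrite /= consK.
  - exact/measurable_EFinP.
  - by rewrite preA; apply: eq_integrable iH => // x _; rewrite /= consK.
  - exact: measurable_angles.
rewrite [LHS]integral_mkcond; set h := ((fun x => (f x.1 * g x.2)%:E) \_ A).
have ih : (leb \x mu)%E.-integrable setT h.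
  by apply/(integrable_mkcond _ mA).
rewrite -(@integral12_prod_meas1 _ _ _ _ R leb mu h ih).
pose J := (\int[mu]_(t in @angles R n) (g t)%:E)%E.
have JE : J = (fine J)%:E by rewrite fineK//; exact: integrable_fin_num.
rewrite -/J JE muleC -integralZl// [RHS]integral_mkcond.
apply: eq_integral => x _; rewrite /fubini_F /= patchE.
case: ifPn => [xP|xP].
  rewrite -JE muleC -integralZl// [RHS]integral_mkcond.
  apply: eq_integral => t _; rewrite /h !patchE.
  by rewrite (_ : ((x, t) \in A) = (t \in @angles R n))// in_setX xP.
rewrite integral0_eq// => t _; rewrite /h patchE.
by rewrite in_setX (negbTE xP).
Qed.

End TensorIntegral.

(** * The mean value property for uniform limits of polynomials *)
Section MeanValue.
Variable R : realType.
Local Notation C := (Cx R).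
Local Notation nc := (@ComplexField.Normc.normc R).
Local Notation rT := (measurableTypeR R).

Lemma cintegral_tensor n (a : rT -> C) (G : n.-tuple rT -> C) :
  measurable_fun setT (fun x => complex.Re (a x)) ->
  measurable_fun setT (fun x => complex.Im (a x)) ->
  (forall x, nc (a x) <= 1) -> tame G ->
  cintegral (fun t : n.+1.-tuple rT => a (thead t) * G [tuple of behead t])
  = cintegral1 a * cintegral G.
Proof.
move=> ar ai a1 [[Gr Gi] [M M0 GM]].
have a1r x : `|complex.Re (a x)| <= 1 by exact: le_trans (Re_le_nc _) (a1 x).
have a1i x : `|complex.Im (a x)| <= 1 by exact: le_trans (Im_le_nc _) (a1 x).
have GMr t : angles t -> `|complex.Re (G t)| <= M.
  by move=> ta; exact: le_trans (Re_le_nc _) (GM t ta).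
have GMi t : angles t -> `|complex.Im (G t)| <= M.
  by move=> ta; exact: le_trans (Im_le_nc _) (GM t ta).
have intH (f : rT -> R) (g : n.-tuple rT -> R) : measurable_fun setT f ->
    measurable_fun setT g -> (forall x, `|f x| <= 1) ->
    (forall t, angles t -> `|g t| <= M) ->
    (lebesgue_tuple R n.+1).-integrable (@angles R n.+1)
      (EFin \o (fun t => f (thead t) * g [tuple of behead t])).
  move=> mf mg f1 gM; apply: (@integrable_bounded _ _ _ (1 * M)).
    apply: measurable_funM; apply: measurableT_comp => //.
      exact: measurable_tnth.
    exact: measurable_behead.
  move=> t ta; rewrite normrM ler_pM// gM// => i.
  by have := ta (lift ord0 i); rewrite {1 2}(tuple_eta t) tnthS.
have mA := @measurable_angles R n.+1.
rewrite /cintegral /cintegral1.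
under eq_Rintegral do rewrite cReM.
under [X in (_ +i* X)%C]eq_Rintegral do rewrite cImM.
rewrite (RintegralB mA (intH _ _ ar Gr a1r GMr) (intH _ _ ai Gi a1i GMi)).
rewrite (RintegralD mA (intH _ _ ar Gi a1r GMi) (intH _ _ ai Gr a1i GMr)).
rewrite (Rintegral_tensor ar Gr a1r GMr) (Rintegral_tensor ai Gi a1i GMi).
by rewrite (Rintegral_tensor ar Gi a1r GMi) (Rintegral_tensor ai Gr a1i GMr).
Qed.

Lemma evalp_monomial n (z : 'rV[C]_n) (m : mpoly.multinom n) :
  evalp (mpoly.mpolyX C m) z = \prod_(i < n) z 0 i ^+ m i.
Proof. by rewrite /evalp mpoly.mevalX. Qed.

(** The integral is the product of the integrals of its one-variable factors,
    and the factor with a positive exponent integrates to [0]. *)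
Lemma cintegral_monomial n (k : 'I_n -> nat) i : (0 < k i)%N ->
  cintegral (fun t : n.-tuple rT => \prod_j expi_row t 0 j ^+ k j) = 0.
Proof.
elim: n k i => [k []//|n IH k i ki].
pose a (x : rT) : C := ((cos x +i* sin x)%C : C) ^+ k ord0.
pose m : mpoly.multinom n := mpoly.Multinom [tuple k (lift ord0 j) | j < n].
pose G (t : n.-tuple rT) := evalp (mpoly.mpolyX C m) (expi_row t).
have GE t : G t = \prod_j expi_row t 0 j ^+ k (lift ord0 j).
  rewrite /G evalp_monomial; apply: eq_bigr => j _.
  by rewrite /m mpoly.mnmE.
have -> : (fun t : n.+1.-tuple rT => \prod_j expi_row t 0 j ^+ k j) =
    fun t => a (thead t) * G [tuple of behead t].
  apply/funext => t; rewrite big_ord_recl expi_row_coord GE; congr (_ * _).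
  apply: eq_bigr => j _; rewrite !expi_row_coord.
  by rewrite {1 2}(tuple_eta t) !tnthS.
rewrite cintegral_tensor; last exact: tame_evalp.
- have [j ij|i0] := unliftP ord0 i.
    rewrite (eq_cintegral (fun t _ => GE t)) (IH (fun j => k (lift ord0 j)) j).
      by rewrite mulr0.
    by rewrite -ij.
  by rewrite /a cintegral1_exp -?i0// mul0r.
- rewrite /a; under eq_fun do rewrite cos_sin_exp /=.
  apply: continuous_measurable_fun => x.
  by apply: continuous_comp; [exact: mulrl_continuous|exact: continuous_cos].
- rewrite /a; under eq_fun do rewrite cos_sin_exp /=.
  apply: continuous_measurable_fun => x.
  by apply: continuous_comp; [exact: mulrl_continuous|exact: continuous_sin].
- by move=> x; rewrite /a ncX /= cos2Dsin2 sqrtr1 expr1n.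
Qed.

Lemma cintegral_cst0 n : cintegral (fun _ : n.-tuple rT => 0 : C) = 0.
Proof.
have := cintegralZl 0 (@tame_cst R n 0).
by under eq_fun do rewrite mul0r; move=> ->; rewrite mul0r.
Qed.

Lemma cintegral_monomial_evalp n (k : 'I_n -> nat) i (p : {mpoly C[n]}) :
  (0 < k i)%N ->
  cintegral (fun t => (\prod_j expi_row t 0 j ^+ k j) * evalp p (expi_row t))
  = 0.
Proof.
move=> ki; pose X t := \prod_j (expi_row t 0 j : C) ^+ k j.
have -> : (fun t => (\prod_j expi_row t 0 j ^+ k j) * evalp p (expi_row t)) =
   fun t => \sum_(m <- mpoly.msupp p) mpoly.mcoeff m p *
       (\prod_j expi_row t 0 j ^+ (k j + m j)).
  apply/funext => t; rewrite /evalp mpoly.mevalE mulr_sumr.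
  apply: eq_bigr => m _; rewrite mulrCA -big_split; congr (_ * _).
  by apply: eq_bigr => j _; rewrite exprD.
have tX (m : mpoly.multinom n) :
    tame (fun t => \prod_j (expi_row t 0 j : C) ^+ (k j + m j)).
  pose m' : mpoly.multinom n := mpoly.Multinom [tuple (k j + m j)%N | j < n].
  rewrite (_ : (fun _ => _) =
      fun t => evalp (mpoly.mpolyX C m') (expi_row t)); first exact: tame_evalp.
  apply/funext => t; rewrite evalp_monomial; apply: eq_bigr => j _.
  by rewrite /m' mpoly.mnmE.
suff H : forall s : seq (mpoly.multinom n),
   tame (fun t : n.-tuple rT => \sum_(m <- s) mpoly.mcoeff m p *
       (\prod_j expi_row t 0 j ^+ (k j + m j))) /\
   cintegral (fun t : n.-tuple rT => \sum_(m <- s) mpoly.mcoeff m p *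
       (\prod_j expi_row t 0 j ^+ (k j + m j))) = 0.
  exact: (H (mpoly.msupp p)).2.
elim=> [|m s [tS IH]].
  under eq_fun do rewrite big_nil.
  by split; [exact: tame_cst|exact: cintegral_cst0].
under eq_fun do rewrite big_cons.
have tm := tameM (@tame_cst R n (mpoly.mcoeff m p)) (tX m).
split; first exact: tameD.
rewrite cintegralD// IH addr0 cintegralZl//.
rewrite (@cintegral_monomial _ (fun j => k j + m j)%N i) ?mulr0//.
by rewrite addn_gt0 ki.
Qed.

(** The mean value property for the function [z^k * F], which vanishes at [0]:
    replacing [F] by a close polynomial does not change much the integral, and
    makes it [0]. *)
Lemma cintegral_monomial_approx n (k : 'I_n -> nat) i (F : n.-tuple rT -> C) :
  (0 < k i)%N -> tame F -> torus_approx F ->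
  cintegral (fun t => (\prod_j expi_row t 0 j ^+ k j) * F t) = 0.
Proof.
move=> ki tF aF.
pose m : mpoly.multinom n := mpoly.Multinom [tuple k j | j < n].
pose X t : C := evalp (mpoly.mpolyX C m) (expi_row t).
have XE t : \prod_j (expi_row t 0 j : C) ^+ k j = X t.
  by rewrite /X evalp_monomial; apply: eq_bigr => j _; rewrite /m mpoly.mnmE.
have tX : tame X by exact: tame_evalp.
have X1 t : nc (X t) = 1.
  rewrite -XE; elim/big_rec: _ => [|j x _ x1]; first exact: nc1.
  by rewrite ncM ncX nc_expi_row expr1n mul1r.
under eq_fun do rewrite XE.
apply: ComplexField.Normc.eq0_normc; apply/eqP; rewrite eq_le nc_ge0 andbT.
apply/ler_addgt0Pl => e e0; rewrite addr0.
have B0 : 0 < 2 * (2 * pi) ^+ n :> R.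
  by rewrite mulr_gt0// exprn_gt0// mulr_gt0// pi_gt0.
have [p Fp] := aF _ (divr_gt0 e0 B0).
have tp := tame_evalp p.
have tN : tame (fun t => F t - evalp p (expi_row t)).
  apply: tameD => //; under eq_fun do rewrite -mulN1r.
  by apply: tameM => //; exact: tame_cst.
have -> : cintegral (fun t => X t * F t) =
    cintegral (fun t => X t * (F t - evalp p (expi_row t))).
  rewrite (_ : (fun t => X t * F t) = fun t =>
    X t * (F t - evalp p (expi_row t)) + X t * evalp p (expi_row t)).
    rewrite cintegralD//; [|exact: tameM|exact: tameM].
    rewrite [X in _ + X](_ : _ = 0) ?addr0//.
    by under eq_fun do rewrite -XE; exact: cintegral_monomial_evalp ki.
  by apply/funext => t; rewrite -mulrDr subrK.
apply: le_trans (cintegral_bound _ _) _; [exact: tameM| |].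
  by move=> t ta; rewrite ncM X1 mul1r; exact: Fp.
by rewrite mulrAC mulrC divfK// gt_eqF.
Qed.

End MeanValue.

(** * Functions that are regular up to the torus *)
Section DiskRegular.
Variables (R : realType) (d : nat).
Local Notation C := (Cx R).
Local Notation nc := (@ComplexField.Normc.normc R).
Local Notation T := (d.-tuple (measurableTypeR R)).
Implicit Types (t : T) (P : {mpoly C[d]}) (f g : 'rV[C]_d -> C).

(** What the proof uses of a holomorphic function that is continuous up to the
    torus.  These properties are preserved by products and hold for [P] and
    for [1 / P], hence for all the functions of the system. *)
Definition disk_regular f :=
  [/\ forall z, polydisk z -> differentiable f z,
      forall t, f (Cof r *: expi_row t) @[r --> (1 : R)^'-] --> f (expi_row t),
      forall r, 0 <= r <= 1 -> cmeasurable (fun t => f (Cof r *: expi_row t)),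
      exists2 M : R, 0 <= M & forall r t, 0 <= r <= 1 -> angles t ->
        nc (f (Cof r *: expi_row t)) <= M &
      torus_approx (fun t => f (expi_row t))].

Lemma disk_regular_cst (c : C) : disk_regular (fun=> c).
Proof.
split=> [z _|t|r _||].
- exact: differentiable_cst.
- exact: cvg_cst.
- exact: cmeasurable_cst.
- by exists (nc c); rewrite ?nc_ge0.
- exact: torus_approx_cst.
Qed.

Lemma disk_regularM f g : disk_regular f -> disk_regular g ->
  disk_regular (fun z => f z * g z).
Proof.
move=> [df cf mf [M M0 fM] af] [dg cg mg [N N0 gN] ag].
split=> [z zD|t|r r01||].
- by apply: differentiableM; [exact: df|exact: dg].
- by apply: cvgM; [exact: cf|exact: cg].
- by apply: cmeasurableM; [exact: mf|exact: mg].
- exists (M * N) => [|r t r01 ta]; first exact: mulr_ge0.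
  by rewrite ncM ler_pM ?nc_ge0 ?fM ?gN.
- exact: torus_approxM.
Qed.

Lemma disk_regular_prod (I : eqType) (s : seq I) (F : I -> 'rV[C]_d -> C) :
  (forall i, i \in s -> disk_regular (F i)) ->
  disk_regular (fun z => \prod_(i <- s) F i z).
Proof.
elim: s => [|i s IH] sF.
  by under eq_fun do rewrite big_nil; exact: disk_regular_cst.
under eq_fun do rewrite big_cons; apply: disk_regularM.
  by apply: sF; rewrite mem_head.
by apply: IH => j js; apply: sF; rewrite inE js orbT.
Qed.

Lemma evalp_radial_cvg P t :
  evalp P (Cof r *: expi_row t) @[r --> (1 : R)^'-] --> evalp P (expi_row t).
Proof.
suff: evalp P (Cof r *: expi_row t) @[r --> (1 : R)^'-] -->
    evalp P (Cof 1 *: expi_row t) by rewrite Cof1 scale1r.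
apply: (@evalp_closed R d _ (fun F : R -> C =>
  F r @[r --> (1 : R)^'-] --> F 1) (fun r => Cof r *: expi_row t)).
- by move=> c; exact: cvg_cst.
- by move=> f g; exact: cvgD.
- by move=> f g; exact: cvgM.
- move=> i; under eq_fun do rewrite radial_coord; rewrite radial_coord.
  apply: cvgM; last exact: cvg_cst.
  by apply: cvg_Cof; apply: cvg_at_left_filter; exact: cvg_id.
Qed.

Lemma evalp_differentiable P z : differentiable (evalp P : 'rV[C]_d -> C) z.
Proof.
apply: (@evalp_closed R d _ (fun f : 'rV[C]_d -> C => differentiable f z) id).
- by move=> c; exact: differentiable_cst.
- by move=> f g; exact: differentiableD.
- by move=> f g; exact: differentiableM.
- by move=> i; exact: differentiable_coord.
Qed.

Lemma disk_regular_evalp P : disk_regular (evalp P).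
Proof.
split=> [z _|t|r _||].
- exact: evalp_differentiable.
- exact: evalp_radial_cvg.
- exact: cmeasurable_radial.
- have [[M M0 PM] _] := evalp_radial_bounded_lipschitz P.
  by exists M => // r t r01 _; exact: PM.
- exact: torus_approx_evalp.
Qed.

Lemma disk_regular_inv P :
  (forall z, polydisk z \/ torus z -> evalp P z != 0) ->
  disk_regular (fun z => (evalp P z)^-1).
Proof.
move=> P0; split=> [z zD|t|r _||].
- apply: differentiableV; first exact: evalp_differentiable.
  by apply: P0; left.
- apply: cvgV; last exact: evalp_radial_cvg.
  by apply: P0; right; exact: expi_row_torus.
- by apply: cmeasurableV; exact: cmeasurable_radial.
- have [c c0 Pc] := evalp_radial_lower_bound P0.
  exists c^-1 => [|r t r01 ta]; first by rewrite invr_ge0 ltW.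
  by rewrite ncV lef_pV2 ?posrE ?(lt_le_trans c0)// Pc.
- exact: torus_approx_inv.
Qed.

Lemma disk_regular_tame f : disk_regular f -> tame (fun t => f (expi_row t)).
Proof.
have r01 : 0 <= (1 : R) <= 1 by rewrite ler01 lexx.
move=> [_ _ /(_ 1 r01) mf [M M0 /(_ 1 _ r01) fM] _].
rewrite (_ : (fun _ => _) = fun t => f (Cof 1 *: expi_row t)); last first.
  by apply/funext => t; rewrite Cof1 scale1r.
by split=> //; exists M.
Qed.

Lemma boundary_value_regular f t : disk_regular f ->
  boundary_value f (expi_row t) = f (expi_row t).
Proof. by move=> [_ cf _ _ _]; apply: cvg_lim => //; exact: cf. Qed.

Lemma hinner_regular f g : disk_regular f -> disk_regular g ->
  hinner f g = Cof ((2 * pi) ^+ d)^-1 *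
    cintegral (fun t => f (expi_row t) * (g (expi_row t))^*).
Proof.
move=> rf rg; rewrite /hinner; congr (_ * _); apply: eq_cintegral => t _.
by rewrite !boundary_value_regular.
Qed.

Lemma hinner_conj f g : disk_regular f -> disk_regular g ->
  hinner f g = (hinner g f)^*.
Proof.
move=> rf rg; rewrite !hinner_regular// rmorphM; congr (_ * _).
  exact/esym/conj_Cof.
have tgf : tame (fun t => g (expi_row t) * (f (expi_row t))^*).
  by apply: tameM; [exact: disk_regular_tame|apply: tame_conj; exact: disk_regular_tame].
apply: etrans (cintegral_conj tgf).
by apply: eq_cintegral => t _; rewrite rmorphM /= conjCK mulrC.
Qed.

(** A bound that is uniform in the radius also bounds all the quadratic means,
    since these are averages. *)
Lemma hardy2_regular f : disk_regular f -> hardy2 f.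
Proof.
move=> [df _ mf [M M0 fM] _]; split => //.
apply: (@le_lt_trans _ _ (M ^+ 2)%:E); last exact: ltry.
apply: ub_ereal_sup => _ [r /= r01 <-].
have {}r01 : 0 <= r <= 1.
  by move: r01; rewrite in_itv/= => /andP[/ltW -> /ltW ->].
have B0 : 0 < (2 * pi) ^+ d :> R by rewrite exprn_gt0// mulr_gt0// pi_gt0.
have mA := @measurable_angles R d.
rewrite /mean_square; apply: (@le_trans _ _
  ((((2 * pi) ^+ d)^-1)%:E * \int[lebesgue_tuple R d]_(t in @angles R d) (M ^+ 2)%:E)%E).
  rewrite lee_pmul2l//; last by rewrite lte_fin invr_gt0.
  apply: ge0_le_integral => //.
  - by move=> t _; rewrite lee_fin sqr_ge0.
  - by apply/measurable_EFinP; apply: measurable_funTS; apply: cmeasurable_nc2; exact: mf.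
  - by move=> t ta; rewrite lee_fin lerXn2r ?nnegrE ?nc_ge0// fM.
have -> : (\int[lebesgue_tuple R d]_(t in @angles R d) (M ^+ 2)%:E =
    (M ^+ 2)%:E * ((2 * pi) ^+ d)%:E)%E.
  rewrite integral_cst//; congr (_ * _)%E; exact: lebesgue_tuple_angles.
by rewrite -!EFinM lee_fin mulrCA mulVf ?mulr1// gt_eqF.
Qed.

End DiskRegular.

(** * The orthonormal system *)
Section Orthonormality.
Variables (R : realType) (d : nat).
Local Notation C := (Cx R).
Local Notation nc := (@ComplexField.Normc.normc R).
Local Notation T := (d.-tuple (measurableTypeR R)).
Implicit Types (t : T) (P : {mpoly C[d]}).

Lemma degp_gt0 P : ~ constp P -> exists i, (0 < degp P i)%N.
Proof.
move=> Pnc; apply: contrapT => deg0; apply: Pnc.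
exists (mpoly.mcoeff (@mpoly.mnm0 d) P).
apply/mpoly.mpolyP => m; rewrite mpoly.mcoeffC.
have [->|m0] := eqVneq (@mpoly.mnm0 d) m; first by rewrite mulr1.
rewrite mulr0; apply: mpoly.memN_msupp_eq0; apply/negP => mP.
move/eqP: m0; apply; apply/mpoly.mnmP => i; rewrite mpoly.mnm0E.
apply/esym/eqP; rewrite -leqn0 leqNgt; apply/negP => mi; apply: deg0.
exists i; apply: leq_trans mi _; rewrite /degp.
exact: (@leq_bigmax_seq _ _ _ (fun m0 : mpoly.multinom d => m0 i)).
Qed.

Lemma evalp_conjp P (z : 'rV[C]_d) :
  evalp (conjp P) (\row_i (z 0 i)^*) = (evalp P z)^*.
Proof.
have inj : injective (Num.conj : C -> C) by exact: fmorph_inj.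
rewrite /evalp /conjp !mpoly.mevalE rmorph_sum /=.
rewrite (perm_big _ (mpoly.msupp_map_mpoly _ inj)) /=.
apply: eq_bigr => m _; rewrite mpoly.mcoeff_map_mpoly rmorphM rmorph_prod.
congr (_ * _); apply: eq_bigr => i _.
by rewrite mxE rmorphXn.
Qed.

(** On the torus the point [1 / z] at which [starpE] evaluates is [conj z]. *)
Lemma starp_torus P t :
  evalp (starp P) (expi_row t) =
  (\prod_i expi_row t 0 i ^+ degp P i) * (evalp P (expi_row t))^*.
Proof.
rewrite starpE; last by move=> i; exact: expi_row_neq0.
congr (_ * _); rewrite -evalp_conjp; congr (evalp _ _).
by apply/rowP => i; rewrite [RHS]mxE [LHS]mxE expi_row_conjV.
Qed.

Lemma monomial_unimodular (k : 'I_d -> nat) t :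
  (\prod_i expi_row t 0 i ^+ k i) * (\prod_i expi_row t 0 i ^+ k i)^* = 1 :> C.
Proof.
rewrite mulr_conj (_ : nc _ = 1) ?expr1n//.
elim/big_rec: _ => [|j x _ x1]; first exact: nc1.
by rewrite ncM ncX nc_expi_row expr1n mul1r.
Qed.

Lemma starp_div_unimodular P t : evalp P (expi_row t) != 0 ->
  let b := evalp (starp P) (expi_row t) / evalp P (expi_row t) in b * b^* = 1.
Proof.
move=> P0 /=; rewrite starp_torus !rmorphM fmorphV /= conjCK.
set x := \prod_i _; set p := evalp P _ in P0 *.
have pc : p^* != 0 by rewrite conjC_eq0.
have := monomial_unimodular (degp P) t; rewrite -/x => xx.
rewrite -xx; field; by rewrite pc P0.
Qed.

Lemma cintegral_Cof (g : T -> R) :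
  cintegral (fun t => Cof (g t)) =
  Cof (\int[lebesgue_tuple R d]_(t in @angles R d) g t).
Proof.
rewrite /cintegral /Cof /=; congr (_ +i* _)%C.
by rewrite Rintegral_cst ?mul0r//; exact: measurable_angles.
Qed.

Lemma hinner_inv P : (forall z, polydisk z \/ torus z -> evalp P z != 0) ->
  exists2 I : R, 0 < I &
    hinner (fun z => (evalp P z)^-1) (fun z => (evalp P z)^-1) = Cof I.
Proof.
move=> P0; have rP := disk_regular_inv P0.
rewrite hinner_regular//.
rewrite (eq_cintegral (fun t _ => mulr_conj _)) cintegral_Cof -CofM; eexists; last reflexivity.
have B0 : 0 < (2 * pi) ^+ d :> R by rewrite exprn_gt0// mulr_gt0// pi_gt0.
rewrite mulr_gt0 ?invr_gt0//.
have [M M0 PM] := evalp_torus_bounded P.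
have M1 : 0 < M + 1 by rewrite ltr_wpDl.
have [mF [N N0 FN]] := disk_regular_tame rP.
have mA := @measurable_angles R d.
apply: (@lt_le_trans _ _ (\int[lebesgue_tuple R d]_(t in @angles R d) (M + 1) ^- 2)).
  rewrite Rintegral_cst// mulr_gt0 ?invr_gt0 ?exprn_gt0//.
  by rewrite (_ : fine _ = (2 * pi) ^+ d)//; exact: (congr1 fine (lebesgue_tuple_angles _ _)).
apply: le_Rintegral => //.
- by apply: (@integrable_bounded _ _ _ `|(M + 1) ^- 2|) => //; exact: measurable_cst.
- apply: (@integrable_bounded _ _ _ (N ^+ 2)); first exact: cmeasurable_nc2.
  by move=> t ta; rewrite ger0_norm ?sqr_ge0// lerXn2r ?nnegrE ?nc_ge0// FN.
- move=> t _.
  have Pt : 0 < nc (evalp P (expi_row t)).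
    by apply/nc_gt0/P0; right; exact: expi_row_torus.
  rewrite ncV exprVn lef_pV2 ?posrE ?exprn_gt0//.
  by rewrite lerXn2r ?nnegrE ?nc_ge0 ?(ltW M1)// (le_trans (PM t))// lerDl.
Qed.

(** The square of the norm of [1 / P] is a positive real number, so that the
    square root in [pnu P] is a positive real number and can be squared back. *)
Lemma pnu_normalizes P :
  (forall z, polydisk z \/ torus z -> evalp P z != 0) ->
  pnu P * (pnu P)^* *
    hinner (fun z => (evalp P z)^-1) (fun z => (evalp P z)^-1) = 1.
Proof.
move=> P0; have [I I0 IE] := hinner_inv P0.
rewrite /pnu /hnorm IE.
have CI0 : 0 <= Cof I :> C by rewrite ler0c ltW.
have s0 : 0 <= (sqrtC (Cof I))^-1 :> C by rewrite invr_ge0 sqrtC_ge0.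
rewrite (CrealP (ger0_real s0)) -invfM -expr2 sqrtCK mulVf//.
by rewrite gt_eqF// ltcR.
Qed.

Definition starp_div_prod (P : nat -> {mpoly C[d]}) (m n : nat) (z : 'rV[C]_d) :=
  \prod_(m <= j < n) (evalp (starp (P j)) z / evalp (P j) z).

Definition system_term (P : nat -> {mpoly C[d]}) (n : nat) (z : 'rV[C]_d) : C :=
  pnu (P n) / evalp (P n) z * starp_div_prod P 1 n z.

Section System.
Variable P : nat -> {mpoly C[d]}.
Hypothesis P0 : forall n : nat, (1 <= n)%N ->
  forall z, polydisk z \/ torus z -> evalp (P n) z != 0.

Lemma starp_div_prod_regular m n : (1 <= m)%N ->
  disk_regular (starp_div_prod P m n).
Proof.
move=> m1; apply: disk_regular_prod => j; rewrite mem_index_iota => /andP[mj _].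
apply: disk_regularM; first exact: disk_regular_evalp.
by apply: disk_regular_inv; apply: P0; exact: leq_trans mj.
Qed.

Lemma system_term_regular n : (1 <= n)%N -> disk_regular (system_term P n).
Proof.
move=> n1; apply: disk_regularM; last exact: starp_div_prod_regular.
apply: disk_regularM; first exact: disk_regular_cst.
by apply: disk_regular_inv; exact: P0.
Qed.

Lemma starp_div_prod_unimodular m n t : (1 <= m)%N ->
  starp_div_prod P m n (expi_row t) * (starp_div_prod P m n (expi_row t))^* = 1.
Proof.
move=> m1; rewrite /starp_div_prod rmorph_prod -big_split /=.
rewrite big_seq big1// => j; rewrite mem_index_iota => /andP[mj _].
apply: starp_div_unimodular; apply: P0; first exact: leq_trans mj.
by right; exact: expi_row_torus.
Qed.

(** The product of the quotients is unimodular, so that the integrand is that of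
    [1 / P n], up to the factor [|pnu (P n)|^2]. *)
Lemma system_term_normed n : (1 <= n)%N ->
  hinner (system_term P n) (system_term P n) = 1.
Proof.
move=> n1; have rV := disk_regular_inv (P0 n1).
rewrite -(pnu_normalizes (P0 n1)) !hinner_regular//;
  [|exact: system_term_regular|exact: system_term_regular].
rewrite [RHS]mulrCA; congr (_ * _).
rewrite -cintegralZl; last first.
  have tV := disk_regular_tame rV.
  exact: tameM tV (tame_conj tV).
apply: eq_cintegral => t _; rewrite /system_term.
set b := starp_div_prod _ _ _ _.
have bb : b * b^* = 1 by exact: starp_div_prod_unimodular.
rewrite !rmorphM /= -[RHS]mulr1 -bb.
by rewrite -!mulrA; congr (_ * _); ring.
Qed.

(** With [h = 1 / P_m * 1 / P_n * prod_(m < j < n) P_j^* / P_j], the integrand is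
    a constant times the conjugate of [z^(deg P_m) * h]; the inverse of [P_m] in
    [h] stems from the denominator of [P_m^* / P_m], while the factor [1 / P_m] of
    the [m]-th function cancels against the conjugate of [P_m^*]. *)
Lemma system_term_orthogonal m n : ~ constp (P m) -> (1 <= m < n)%N ->
  hinner (system_term P m) (system_term P n) = 0.
Proof.
move=> Pm /andP[m1 mn]; have n1 : (1 <= n)%N by exact: leq_trans mn.
have [i di] := degp_gt0 Pm.
rewrite hinner_regular; [|exact: system_term_regular|exact: system_term_regular].
pose h z := (evalp (P m) z)^-1 * (evalp (P n) z)^-1 * starp_div_prod P m.+1 n z.
have rh : disk_regular h.
  apply: disk_regularM; last exact: starp_div_prod_regular.
  by apply: disk_regularM; apply: disk_regular_inv; exact: P0.
pose X t := \prod_j (expi_row t 0 j : C) ^+ degp (P m) j.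
have Xh : cintegral (fun t => X t * h (expi_row t)) = 0.
  apply: (cintegral_monomial_approx di); first exact: disk_regular_tame.
  by case: rh.
have tXh : tame (fun t => X t * h (expi_row t)).
  apply: tameM; last exact: disk_regular_tame.
  pose k : mpoly.multinom d := mpoly.Multinom [tuple degp (P m) j | j < d].
  rewrite (_ : X = fun t => evalp (mpoly.mpolyX C k) (expi_row t)).
    exact: tame_evalp.
  apply/funext => t; rewrite evalp_monomial; apply: eq_bigr => j _.
  by rewrite /k mpoly.mnmE.
have -> : cintegral (fun t => system_term P m (expi_row t) *
      (system_term P n (expi_row t))^*) =
    cintegral (fun t => pnu (P m) * (pnu (P n))^* * (X t * h (expi_row t))^*).
  apply: eq_cintegral => t _.
  have Pm0 : evalp (P m) (expi_row t) != 0.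
    by apply: P0 => //; right; exact: expi_row_torus.
  rewrite /system_term /h [starp_div_prod P 1 n _](@big_cat_nat _ _ _ m)//=; last exact: ltnW.
  rewrite [\prod_(m <= j < n) _]big_ltn//.
  rewrite -[\prod_(1 <= j < m) _]/(starp_div_prod P 1 m (expi_row t)).
  rewrite -[\prod_(m.+1 <= j < n) _]/(starp_div_prod P m.+1 n (expi_row t)).
  rewrite starp_torus -/(X t).
  have := @starp_div_prod_unimodular 1 m t isT.
  move: (starp_div_prod P 1 m _) (starp_div_prod P m.+1 n _) => b c bb.
  have Pn0 : evalp (P n) (expi_row t) != 0.
    by apply: P0 => //; right; exact: expi_row_torus.
  move: (X t) (evalp (P n) _) (evalp (P m) _) Pn0 Pm0 => x q p q0 p0.
  move: (pnu (P m)) (pnu (P n)) => u v.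
  have [qc0 pc0] : q^* != 0 /\ p^* != 0 by rewrite !conjC_eq0.
  rewrite !rmorphM !fmorphV /= !conjCK -[RHS]mulr1 -bb.
  by field; rewrite qc0 pc0 p0.
rewrite (cintegralZl _ (tame_conj tXh)) (cintegral_conj tXh) Xh.
by rewrite conjC0 !mulr0.
Qed.

End System.

End Orthonormality.

Theorem corollary1 (R : realType) (d : nat) (P : nat -> {mpoly (Cx R)[d]})
    (hd : (1 <= d)%N)
    (hP : forall n : nat, (1 <= n)%N -> regular_poly (P n)) :
  orthonormal_system [set n : nat | (1 <= n)%N]
    (fun (n : nat) (z : 'rV[Cx R]_d) =>
       pnu (P n) / evalp (P n) z *
       \prod_(1 <= j < n) (evalp (starp (P j)) z / evalp (P j) z)).
Proof.
have P0 n : (1 <= n)%N -> forall z, polydisk z \/ torus z -> evalp (P n) z != 0.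
  by move=> /hP[].
have Pnc n : (1 <= n)%N -> ~ constp (P n) by move=> /hP[].
split=> [n n1|m n m1 n1]; first exact/hardy2_regular/(system_term_regular P0).
have [mn|nm|<-] := ltngtP m n.
- by apply: (system_term_orthogonal P0) => //; [exact: Pnc|rewrite mn andbT].
- rewrite hinner_conj; [|exact: (system_term_regular P0)..].
  rewrite [X in X^*](_ : _ = 0) ?conjC0//.
  by apply: (system_term_orthogonal P0) => //; [exact: Pnc|rewrite nm andbT].
- exact: (system_term_normed P0).
Qed.
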